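(* Let $K\subset\mathbb R^2$ be a closed convex set which is contained in an angle and contains a half-line (in particular, let $K$ be any parabolic domain). Then for every $0<\varepsilon<1/2$ there exist constants $\theta>0$, $C>0$ and a continuous function $f\colon K^c\to\mathbb R$, not identically zero, such that $|f(x)|\le C\exp(-\theta|x|^{1/2-\varepsilon})$ for all $x\in K^c$, and the classical Radon transform of $f$ vanishes on every line avoiding $K$, i.e. $\int_{l}f(x)\,dx=0$ (with respect to Lebesgue measure on $l$) for every line $l\subset K^c$.
   Context: $K^c=\mathbb R^2\setminus K$. An angle is the intersection of two half-planes with different normal vectors. A parabolic domain is an unbounded closed convex set contained in an angle such that all directed half-lines in it are parallel. *)

(* Defs.v *)
(* MathComp-Analysis; the plane R^2 is the product R * R. *)
From HB Require Import structures.
From mathcomp Require Import all_boot all_order all_algebra.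
From mathcomp Require Import all_classical all_reals all_analysis.

Set Implicit Arguments.
Unset Strict Implicit.
Unset Printing Implicit Defensive.

Import Order.TTheory GRing.Theory Num.Theory.
Import numFieldNormedType.Exports.

Local Open Scope classical_set_scope.
Local Open Scope ring_scope.

Definition dotp (R : realType) (u v : R * R) : R := u.1 * v.1 + u.2 * v.2.

(* The library norm `|x| on R * R is the max norm. *)
Definition enorm (R : realType) (x : R * R) : R := Num.sqrt (dotp x x).

Definition half_plane (R : realType) (n : R * R) (c : R) : set (R * R) :=
  [set x | dotp n x <= c].

(* Normal vectors are outer unit normals, so distinct normals mean that neither
   half-plane contains the other.  Opposite normals are allowed: a strip counts
   as an angle. *)
Definition angle (R : realType) (A : set (R * R)) : Prop :=
  exists n1 n2 : R * R, exists c1 c2 : R,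
    [/\ enorm n1 = 1, enorm n2 = 1, n1 <> n2 &
        A = half_plane n1 c1 `&` half_plane n2 c2].

Definition contained_in_angle (R : realType) (K : set (R * R)) : Prop :=
  exists2 A : set (R * R), angle A & K `<=` A.

(* Directions v of lines and half-lines below are always taken of norm 1. *)
Definition half_line (R : realType) (p v : R * R) : set (R * R) :=
  [set p + t *: v | t in [set t : R | 0 <= t]].

Definition contains_half_line (R : realType) (K : set (R * R)) : Prop :=
  exists p v : R * R, enorm v = 1 /\ half_line p v `<=` K.

(* Directed half-lines are parallel when they have the same unit direction. *)
Definition parabolic_domain (R : realType) (K : set (R * R)) : Prop :=
  [/\ closed K, convex_set K, ~ bounded_set K, contained_in_angle K &
      forall p v q w : R * R, enorm v = 1 -> enorm w = 1 ->
        half_line p v `<=` K -> half_line q w `<=` K -> v = w].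

Definition line (R : realType) (p v : R * R) : set (R * R) :=
  [set p + t *: v | t in [set: R]].

(* For enorm v = 1 the map t |-> p + t *: v is an arc-length parametrization, so
   this is the integral of f over line p v for the Lebesgue measure of the line.
   It is extended-real valued, and as +oo - +oo = -oo in \bar R, the value 0 is
   never taken by a divergent integral. *)
Definition line_integral (R : realType) (f : R * R -> R) (p v : R * R) : \bar R :=
  (\int[@lebesgue_measure R]_(t in [set: R]) (f (p + t *: v))%:E)%E.

(* Main.v *)
(* By restricting to a half-line L contained in K (a direction of recession when K is
   a parabolic domain) one may replace K by L, provided f does not vanish identically on
   the half-plane left free by the angle.  Put L on the nonpositive real axis of the
   complex plane and let a = 1/2 - eps, Phi(w) = w exp(- w^a), f = Re Phi'.  On the slit
   plane |arg (w^a)| < a pi < pi / 2, so Phi and Phi' = (1 - a w^a) exp(- w^a) decay like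
   exp(- theta |w|^a); the factor w in Phi keeps Phi' bounded at the tip of L.  Since f is
   the derivative of Re (conj v * Phi) along a line of unit direction v, its integral over
   a line avoiding L is the difference of the limits of this primitive, which are 0. *)
Require Import Defs.
From HB Require Import structures.
From mathcomp Require Import all_boot all_order all_algebra.
From mathcomp Require Import all_classical all_reals all_analysis.
From mathcomp Require Import measurable_realfun.
From mathcomp Require Import ring lra.
Import Order.TTheory GRing.Theory Num.Theory.
Import numFieldNormedType.Exports.
Local Open Scope classical_set_scope.
Local Open Scope ring_scope.

Set Implicit Arguments.
Unset Strict Implicit.
Unset Printing Implicit Defensive.

(** * The holomorphic function in polar coordinates *)

Section polar.
Context {R : realType}.
Implicit Types (w v x y : R * R) (a t : R).

Lemma dotpp_ge0 w : 0 <= dotp w w.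
Proof. by rewrite /dotp -!expr2 addr_ge0 // sqr_ge0. Qed.

Lemma enorm_ge0 w : 0 <= enorm w.
Proof. exact: sqrtr_ge0. Qed.

Lemma sqr_enorm w : enorm w ^+ 2 = w.1 ^+ 2 + w.2 ^+ 2.
Proof. by rewrite sqr_sqrtr ?dotpp_ge0. Qed.

Lemma enorm1_dotp w : enorm w = 1 -> w.1 ^+ 2 + w.2 ^+ 2 = 1.
Proof. by move=> w1; rewrite -sqr_enorm w1 expr1n. Qed.

Lemma enormZ (s : R) w : 0 <= s -> enorm (s *: w) = s * enorm w.
Proof.
move=> s0; apply/eqP; rewrite -(@eqrXn2 _ 2) ?mulr_ge0 ?enorm_ge0//.
by rewrite exprMn !sqr_enorm /=; apply/eqP; rewrite /GRing.scale/=; ring.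
Qed.

(* Lagrange's identity: |conj(v) w|^2 = |v|^2 |w|^2 in the real and imaginary parts. *)
Lemma dotp_cross v w : enorm v ^+ 2 * enorm w ^+ 2 =
  dotp v w ^+ 2 + (v.1 * w.2 - v.2 * w.1) ^+ 2.
Proof. by rewrite !sqr_enorm /dotp; ring. Qed.

Lemma enormN x : enorm (- x) = enorm x.
Proof. by rewrite /enorm /dotp /= !mulrNN. Qed.

(** Square both sides; Cauchy-Schwarz is Lagrange's identity with the cross term dropped. *)
Lemma enormD x y : enorm (x + y) <= enorm x + enorm y.
Proof.
rewrite -(@ler_sqr R) ?nnegrE ?addr_ge0 ?enorm_ge0// sqrrD !sqr_enorm.
have xy : dotp x y <= enorm x * enorm y.
  rewrite (le_trans (ler_norm _))// -(@ler_sqr R) ?nnegrE ?mulr_ge0 ?enorm_ge0//.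
  by rewrite real_normK ?num_real// exprMn dotp_cross lerDl sqr_ge0.
have -> : (x + y).1 ^+ 2 + (x + y).2 ^+ 2 =
  x.1 ^+ 2 + x.2 ^+ 2 + dotp x y *+ 2 + (y.1 ^+ 2 + y.2 ^+ 2).
  by rewrite /dotp /=; ring.
by rewrite lerD2r lerD2l lerMn2r.
Qed.

Lemma enorm_eq0 w : enorm w = 0 -> w = 0.
Proof.
move=> w0; have := sqr_enorm w; rewrite w0 expr0n /= => /esym/eqP.
rewrite paddr_eq0 ?sqr_ge0// !sqrf_eq0 => /andP[/eqP w1 /eqP w2].
by case: w w1 w2 {w0} => ? ? /= -> ->.
Qed.

Lemma powR_pred (x a : R) : 0 < x -> x `^ (a - 1) = x `^ a / x.
Proof. by move=> x0; rewrite powRB ?powRr1 ?ltW// (gt_eqF x0) implybT. Qed.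

(** The complex plane cut along the nonpositive real axis, which is exactly where |w| + Re w = 0. *)
Definition slit : set (R * R) := [set w | 0 < enorm w + w.1].

(* The argument of w in ]-pi, pi[, by the half-angle formula; meaningless off slit,
   where the denominator is 0. *)
Definition arg w : R := 2 * atan (w.2 / (enorm w + w.1)).

Lemma slit_gt0 w : slit w -> 0 < enorm w.
Proof.
rewrite /slit/= => sw; have := sqr_enorm w; have := enorm_ge0 w; nra.
Qed.

(* repow + i impow is the principal branch of w ^ a. *)
Definition repow a w : R := enorm w `^ a * cos (a * arg w).
Definition impow a w : R := enorm w `^ a * sin (a * arg w).

(* With Phi w = w exp(- w ^ a), Fre is Re (Phi' w) and Phire is Re (conj v * Phi w). *)
Definition Fre a w : R := expR (- repow a w) *
  ((1 - a * repow a w) * cos (impow a w) - a * impow a w * sin (impow a w)).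

Definition Phire a v w : R := expR (- repow a w) *
  (dotp v w * cos (impow a w) + (v.1 * w.2 - v.2 * w.1) * sin (impow a w)).

(** * Derivatives along a curve with velocity [v] at time [t] *)

Section along_a_curve.
Variables (z : R -> R * R) (v : R * R) (t : R).
Hypothesis is_derive_coord1 : is_derive t 1 (fun t => (z t).1) v.1.
Hypothesis is_derive_coord2 : is_derive t 1 (fun t => (z t).2) v.2.

Lemma is_derive_enorm : 0 < enorm (z t) ->
  is_derive t 1 (fun t => enorm (z t)) (dotp v (z t) / enorm (z t)).
Proof.
move=> r0.
have d0 : 0 < dotp (z t) (z t) by rewrite -sqrtr_gt0.
have dd : is_derive t 1 (fun t => dotp (z t) (z t)) (2 * dotp v (z t)).
  have d1 := is_derive_coord1; have d2 := is_derive_coord2.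
  apply: is_derive_eq (is_deriveD (is_deriveM d1 d1) (is_deriveM d2 d2)) _.
  by rewrite /dotp /GRing.scale/=; ring.
have dc := is_derive1_comp (g := fun t => dotp (z t) (z t)) (is_derive1_sqrt d0) dd.
apply: is_derive_eq dc _.
by rewrite /enorm; field; rewrite gt_eqF// sqrtr_gt0.
Qed.

(** The value is Im (v / z), as arg is the imaginary part of log. *)
Lemma is_derive_arg : slit (z t) ->
  is_derive t 1 (fun t => arg (z t))
    ((v.2 * (z t).1 - v.1 * (z t).2) / enorm (z t) ^+ 2).
Proof.
move=> st; have r0 := slit_gt0 st.
have dr := is_derive_enorm r0.
have s0 : enorm (z t) + (z t).1 != 0 by rewrite gt_eqF.
have dd : is_derive t 1 (fun t => (z t).2 / (enorm (z t) + (z t).1))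
   ((v.2 * (enorm (z t) + (z t).1) - (z t).2 * (dotp v (z t) / enorm (z t) + v.1))
     / (enorm (z t) + (z t).1) ^+ 2).
  have di := is_deriveV (f := fun t => enorm (z t) + (z t).1) s0 (is_deriveD dr (is_derive_coord1)).
  apply: is_derive_eq (is_deriveM (is_derive_coord2) di) _.
  by rewrite /GRing.scale/=; field; rewrite s0 gt_eqF.
have da : is_derive t 1 (fun t => 2 * atan ((z t).2 / (enorm (z t) + (z t).1))) _ :=
  is_deriveZ 2 (is_derive1_comp (g := fun t => (z t).2 / (enorm (z t) + (z t).1))
    (is_derive1_atan _) dd).
apply: is_derive_eq da _.
rewrite /GRing.scale/=.
have := sqr_enorm (z t); rewrite /dotp.
move: (enorm _) (z t).1 (z t).2 s0 r0 => r x y s0 r0 r2.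
have rN0 : r != 0 by rewrite gt_eqF.
(* The denominator in the derivative of atan, simplified by y^2 = (r - x)(r + x). *)
have -> : 1 + (y / (r + x)) ^+ 2 = 2 * r / (r + x).
  have -> : (y / (r + x)) ^+ 2 = (r ^+ 2 - x ^+ 2) / (r + x) ^+ 2.
    by rewrite r2; field.
  by field.
have <- : (v.2 * r * (r + x) - y * (v.1 * x + v.2 * y + v.1 * r)) / (r ^+ 2 * (r + x))
    = (v.2 * x - v.1 * y) / r ^+ 2.
  have -> : v.2 * r * (r + x) - y * (v.1 * x + v.2 * y + v.1 * r) =
     (v.2 * x - v.1 * y) * (r + x) + v.2 * (r ^+ 2 - (x ^+ 2 + y ^+ 2)) by ring.
  by rewrite -r2; field; rewrite rN0.
by field; rewrite s0 rN0.
Qed.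

Variable a : R.

(** This and [is_derive_impow] are the real and imaginary parts of (z^a)' = a z^a (conj z * v) /
    |z|^2. *)
Lemma is_derive_repow : slit (z t) -> is_derive t 1 (fun t => repow a (z t))
  (a * (dotp v (z t) * repow a (z t) - (v.2 * (z t).1 - v.1 * (z t).2) * impow a (z t))
    / enorm (z t) ^+ 2).
Proof.
move=> st; have r0 := slit_gt0 st.
have dr := is_derive1_comp (g := fun t => enorm (z t)) (is_derive1_powR a r0) (is_derive_enorm r0).
have da := is_deriveZ a (is_derive_arg st).
have dc := is_derive1_comp (g := fun t => a * arg (z t)) (is_derive_cos (a * arg (z t))) da.
apply: is_derive_eq (is_deriveM dr dc) _.
rewrite /repow /impow /= powR_pred// /GRing.scale/=.
by field; rewrite gt_eqF.
Qed.

Lemma is_derive_impow : slit (z t) -> is_derive t 1 (fun t => impow a (z t))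
  (a * (dotp v (z t) * impow a (z t) + (v.2 * (z t).1 - v.1 * (z t).2) * repow a (z t))
    / enorm (z t) ^+ 2).
Proof.
move=> st; have r0 := slit_gt0 st.
have dr := is_derive1_comp (g := fun t => enorm (z t)) (is_derive1_powR a r0) (is_derive_enorm r0).
have da := is_deriveZ a (is_derive_arg st).
have ds := is_derive1_comp (g := fun t => a * arg (z t)) (is_derive_sin (a * arg (z t))) da.
apply: is_derive_eq (is_deriveM dr ds) _.
rewrite /repow /impow /= powR_pred// /GRing.scale/=.
by field; rewrite gt_eqF.
Qed.

(** The derivative of conj v * Phi(z) is conj v * v * Phi'(z), and conj v * v = 1. *)
Lemma is_derive_Phire : enorm v = 1 -> slit (z t) ->
  is_derive t 1 (fun t => Phire a v (z t)) (Fre a (z t)).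
Proof.
move=> v1 st; have r0 := slit_gt0 st.
have dP := is_derive_repow st.
have dQ := is_derive_impow st.
have dc := is_derive1_comp (g := fun t => impow a (z t)) (is_derive_cos (impow a (z t))) dQ.
have ds := is_derive1_comp (g := fun t => impow a (z t)) (is_derive_sin (impow a (z t))) dQ.
have de := is_derive1_comp (g := fun t => - repow a (z t)) (is_derive_expR _) (is_deriveN dP).
(* conj v * z has derivative |v|^2 = 1: its real part has slope 1, its imaginary part slope 0. *)
have dX : is_derive t 1 (fun t => dotp v (z t)) 1.
  apply: is_derive_eq (is_deriveD (is_deriveZ v.1 is_derive_coord1)
    (is_deriveZ v.2 is_derive_coord2)) _.
  by rewrite /GRing.scale/= -!expr2 enorm1_dotp.
have dY : is_derive t 1 (fun t => v.1 * (z t).2 - v.2 * (z t).1) 0.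
  apply: is_derive_eq (is_deriveB (is_deriveZ v.1 is_derive_coord2)
    (is_deriveZ v.2 is_derive_coord1)) _.
  by rewrite /GRing.scale/= mulrC subrr.
have dB : is_derive t 1 (fun t => dotp v (z t) * cos (impow a (z t)) +
    (v.1 * (z t).2 - v.2 * (z t).1) * sin (impow a (z t))) _ :=
  is_deriveD (is_deriveM dX dc) (is_deriveM dY ds).
apply: is_derive_eq (is_deriveM de dB) _.
have := dotp_cross v (z t); rewrite v1 expr1n mul1r.
rewrite /Fre /GRing.scale/= -opprB sqrrN.
move: (enorm (z t)) r0 (dotp _ _) (repow _ _) (impow _ _) (_ - _)
  => r r0 X P Q Y r2.
move: (expR _) (cos _) (sin _) => E C S.
have rN0 : r != 0 by rewrite gt_eqF.
transitivity (E * (C - a * (S * Q + C * P) * ((X ^+ 2 + Y ^+ 2) / r ^+ 2))).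
  by field.
by rewrite -r2 divff ?expf_neq0//; ring.
Qed.

End along_a_curve.

(** * Continuity on the slit plane *)

Lemma continuous_enorm w : {for w, continuous (@enorm R)}.
Proof.
apply: (continuous_comp (f := fun w : R * R => dotp w w) (g := Num.sqrt));
  last exact: sqrt_continuous.
by apply: cvgD; apply: cvgM; (exact: cvg_fst || exact: cvg_snd).
Qed.

Lemma continuous_arg w : slit w -> {for w, continuous arg}.
Proof.
move=> sw; apply: cvgM; first exact: cvg_cst.
apply: (continuous_comp (f := fun w : R * R => w.2 / (enorm w + w.1)) (g := atan));
  last exact: continuous_atan.
apply: cvgM; first exact: cvg_snd.
apply: cvgV; first by rewrite gt_eqF.
by apply: cvgD; [exact: continuous_enorm|exact: cvg_fst].
Qed.

Lemma continuous_enorm_pow a w : slit w -> {for w, continuous (fun w => enorm w `^ a)}.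
Proof.
move=> sw; have cr : {for w, continuous (@enorm R)} by exact: continuous_enorm.
apply: (continuous_comp (g := fun x : R => x `^ a) cr).
have [+ _] := is_derive1_powR a (slit_gt0 sw).
by move=> /derivable1_diffP /differentiable_continuous.
Qed.

Lemma continuous_repow a w : slit w -> {for w, continuous (repow a)}.
Proof.
move=> sw; apply: cvgM; first exact: continuous_enorm_pow.
apply: (continuous_comp (f := fun w => a * arg w) (g := cos)); last exact: continuous_cos.
by apply: cvgM; [exact: cvg_cst|exact: continuous_arg].
Qed.

Lemma continuous_impow a w : slit w -> {for w, continuous (impow a)}.
Proof.
move=> sw; apply: cvgM; first exact: continuous_enorm_pow.
apply: (continuous_comp (f := fun w => a * arg w) (g := sin)); last exact: continuous_sin.
by apply: cvgM; [exact: cvg_cst|exact: continuous_arg].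
Qed.

Lemma continuous_Fre a w : slit w -> {for w, continuous (Fre a)}.
Proof.
move=> sw; have cP := continuous_repow (a := a) sw; have cQ := continuous_impow (a := a) sw.
have cC : {for w, continuous (fun w => cos (impow a w))}.
  by apply: (continuous_comp (f := impow a) (g := cos)) => //; exact: continuous_cos.
have cS : {for w, continuous (fun w => sin (impow a w))}.
  by apply: (continuous_comp (f := impow a) (g := sin)) => //; exact: continuous_sin.
apply: cvgM.
  apply: (continuous_comp (f := fun w => - repow a w) (g := expR)); last exact: continuous_expR.
  exact: cvgN.
apply: cvgB; apply: cvgM => //; last by apply: cvgM => //; exact: cvg_cst.
by apply: cvgB; [exact: cvg_cst|apply: cvgM => //; exact: cvg_cst].
Qed.

End polar.

(** * Decay estimates *)

Section bounds.
Context {R : realType}.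
Implicit Types (w v : R * R) (a t : R).

Lemma normr_arg w : `|arg w| <= pi.
Proof.
rewrite /arg normrM ger0_norm// -ler_pdivlMl// [2^-1 * _]mulrC ler_norml.
by rewrite !ltW ?atan_gtNpi2 ?atan_ltpi2.
Qed.

Lemma cos_norm (x : R) : cos `|x| = cos x.
Proof. by case: (ger0P x) => // _; rewrite cosN. Qed.

(** Since |a arg w| <= a pi <= pi and cosine is even and decreasing on [0, pi], cos (a arg w) is at
    least cos (a pi). *)
Lemma ler_repow a w : 0 < a -> a < 2^-1 -> cos (a * pi) * enorm w `^ a <= repow a w.
Proof.
move=> a0 a2; rewrite /repow mulrC ler_wpM2l ?powR_ge0// -[leRHS]cos_norm.
have p0 := @pi_gt0 R.
have aw : `|a * arg w| <= a * pi by rewrite normrM gtr0_norm// ler_pM2l// normr_arg.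
have api : a * pi <= pi by nra.
rewrite leNgt ltr_cos ?in_itv/= ?normr_ge0 -?leNgt//=; first by rewrite api; nra.
exact: le_trans api.
Qed.

(** The rate of decay is positive because a < 1/2 keeps a pi below pi / 2. *)
Lemma cos_api_gt0 a : 0 < a -> a < 2^-1 -> 0 < cos (a * pi).
Proof.
by move=> a0 a2; apply: cos_gt0_pihalf; have := @pi_gt0 R; nra.
Qed.

Lemma normr_mul_le (x y : R) : `|y| <= 1 -> `|x * y| <= `|x|.
Proof. by move=> y1; rewrite normrM ler_piMr. Qed.

Lemma normr_Fre a w : 0 < a -> a < 2^-1 ->
  `|Fre a w| <= expR (- (cos (a * pi) * enorm w `^ a)) * (1 + enorm w `^ a).
Proof.
move=> a0 a2; rewrite /Fre normrM ger0_norm ?expR_ge0// ler_pM ?expR_ge0//.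
  by rewrite ler_expR lerN2 ler_repow.
have r0 := powR_ge0 (enorm w) a.
have P : `|repow a w| <= enorm w `^ a.
  by rewrite (le_trans (normr_mul_le _ (cos_max _)))// ger0_norm.
have Q : `|impow a w| <= enorm w `^ a.
  by rewrite (le_trans (normr_mul_le _ (sin_max _)))// ger0_norm.
rewrite (le_trans (ler_normB _ _))//.
(* The two terms add up to 1 + 2 a |w|^a, and 2 a < 1. *)
apply: (@le_trans _ _ ((1 + a * enorm w `^ a) + a * enorm w `^ a)); last by nra.
rewrite lerD// (le_trans (normr_mul_le _ _)) ?cos_max ?sin_max//.
  by rewrite (le_trans (ler_normB _ _))// normr1 lerD2l normrM gtr0_norm// ler_pM2l.
by rewrite normrM gtr0_norm// ler_pM2l.
Qed.

Lemma normr_Phire a v w : 0 < a -> a < 2^-1 -> enorm v = 1 ->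
  `|Phire a v w| <= expR (- (cos (a * pi) * enorm w `^ a)) * enorm w.
Proof.
move=> a0 a2 v1; rewrite /Phire normrM ger0_norm ?expR_ge0// ler_pM ?expR_ge0//.
  by rewrite ler_expR lerN2 ler_repow.
have := dotp_cross v w; rewrite v1 expr1n mul1r.
move: (dotp v w) (_ - _) => X Y r2.
have := cos2Dsin2 (impow a w); move: (cos _) (sin _) => C S CS.
rewrite -ler_sqr ?nnegrE ?enorm_ge0// real_normK ?num_real// r2.
rewrite -[leRHS]mulr1 -CS -subr_ge0.
(* Cauchy-Schwarz for (X, Y) and (C, S), again by Lagrange's identity. *)
have -> : (X ^+ 2 + Y ^+ 2) * (C ^+ 2 + S ^+ 2) - (X * C + Y * S) ^+ 2 =
  (X * S - Y * C) ^+ 2 by ring.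
exact: sqr_ge0.
Qed.

Lemma expR_dominates_expn (x : R) n : 0 <= x -> x ^+ n <= n`!%:R * expR x.
Proof.
move=> x0; case: n => [|n].
  by rewrite fact0 mul1r (le_trans _ (expR_ge1Dx x))// lerDl.
rewrite mulrC -ler_pdivrMr ?ltr0n ?fact_gt0//.
by rewrite (le_trans _ (expR_ge1Dxn n x0))// lerDr.
Qed.

(** Quadratic decay suffices both for domination by an integrable function and for vanishing
    boundary terms. *)
Lemma stretched_exp_decay (k a : R) : 0 < k -> 0 < a -> a <= 1 ->
  exists2 C : R, 0 < C &
    forall r, 0 <= r -> expR (- (k * r `^ a)) * (1 + r `^ a) <= C / (1 + r ^+ 2).
Proof.
(* With a n >= 3, the n-th power of r^a is at least r^3 for r >= 1. *)
move=> k0 a0 a1; pose n := (Num.trunc (3 / a)).+1.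
have na : 3 <= a * n%:R.
  by rewrite mulrC -ler_pdivrMr// ltW// /n truncnS_gt.
have kn0 : 0 < k ^+ n by rewrite exprn_gt0.
have n0 : 0 < n`!%:R :> R by rewrite ltr0n fact_gt0.
(* The first 4 serves r <= 1; the other term serves r > 1, where (1 + r^a)(1 + r^2) <= 4 r^3. *)
exists (4 + 4 * (n`!%:R / k ^+ n)); first by rewrite addr_gt0// mulr_gt0// divr_gt0.
move=> r r0; have r2 : 0 < 1 + r ^+ 2 by rewrite ltr_pwDl// sqr_ge0.
rewrite ler_pdivlMr// expRN -mulrA [_^-1 * _]mulrC ler_pdivrMr ?expR_gt0//.
set p := r `^ a.
have p0 : 0 <= p := powR_ge0 _ _.
have kp0 : 0 <= k * p by rewrite mulr_ge0// ltW.
have e1 : 1 <= expR (k * p) by rewrite -expR0 ler_expR.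
have [r1|r1] := leP r 1.
  have := ge0_ler_powR (ltW a0) r0 ler01 r1; rewrite powR1 -/p => p1.
  have : 0 <= 4 * (n`!%:R / k ^+ n) * expR (k * p).
    by rewrite mulr_ge0 ?expR_ge0// mulr_ge0// ltW// divr_gt0.
  have : r ^+ 2 <= 1 by rewrite expr_le1.
  nra.
have pr : p <= r by exact: ler1_powR (ltW r1) a1.
have r3 : r ^+ 3 <= n`!%:R / k ^+ n * expR (k * p).
  rewrite -mulrA [k ^- n * _]mulrC mulrA ler_pdivlMr//.
  rewrite (le_trans _ (expR_dominates_expn n kp0))// exprMn mulrC ler_pM2l//.
  by rewrite /p -!powR_mulrn ?powR_ge0// -powRrM ler_powR// ltW.
have := expR_ge0 (k * p).
have : (1 + p) * (1 + r ^+ 2) <= 4 * r ^+ 3 by rewrite !exprS expr0; nra.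
move: (n`!%:R / _) (expR _) r3 => q e r3; nra.
Qed.

(** Half of the exponent absorbs the factor 1 + x, by exp(k x / 2) >= 1 + k x / 2. *)
Lemma stretched_exp_absorb (k x : R) : 0 < k -> 0 <= x ->
  expR (- (k * x)) * (1 + x) <= (1 + 2 / k) * expR (- (k / 2 * x)).
Proof.
move=> k0 x0; have -> : - (k * x) = - (k / 2 * x) - k / 2 * x by field.
rewrite expRD -mulrA mulrC ler_pM2r ?expR_gt0//.
rewrite expRN mulrC ler_pdivrMr ?expR_gt0//.
have e : 1 + k / 2 * x <= expR (k / 2 * x) by exact: expR_ge1Dx.
have ik : 0 < 2 / k by rewrite divr_gt0.
apply: (@le_trans _ _ ((1 + 2 / k) * (1 + k / 2 * x))); last by rewrite ler_pM2l//; lra.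
have -> : (1 + 2 / k) * (1 + k / 2 * x) = 1 + x + (2 / k + k / 2 * x) by field; rewrite gt_eqF.
by rewrite lerDl addr_ge0 ?(ltW ik)// mulr_ge0// divr_ge0// ltW.
Qed.

(** A fraction q in [0, 1] satisfies q <= q^a; apply this to x / (x + y) and y / (x + y), whose sum
    is 1. *)
Lemma powR_subadditive (x y a : R) : 0 <= x -> 0 <= y -> 0 < a -> a <= 1 ->
  (x + y) `^ a <= x `^ a + y `^ a.
Proof.
move=> x0 y0 a0 a1; have := addr_ge0 x0 y0; rewrite le_eqVlt => /predU1P[<-|s0].
  by rewrite powR0 ?gt_eqF// addr_ge0 ?powR_ge0.
have piece u : 0 <= u -> u <= x + y -> u / (x + y) * (x + y) `^ a <= u `^ a.
  rewrite le_eqVlt => /predU1P[<- _|u0 us]; first by rewrite !mul0r powR_ge0.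
  rewrite -{2}(divfK (lt0r_neq0 s0) u) powRM ?(ltW s0) ?(ltW (divr_gt0 u0 s0))// ler_pM2r ?powR_gt0//.
  by rewrite ger1_powR// divr_gt0//= ler_pdivrMr// mul1r.
have := lerD (piece _ x0 _) (piece _ y0 _); rewrite -mulrDl -mulrDl divff ?gt_eqF// mul1r.
by apply; rewrite ?lerDl ?lerDr.
Qed.

End bounds.

(** * Integrals over lines and non-vanishing *)

Section line_integrals.
Context {R : realType}.
Let mu := @lebesgue_measure R.

Lemma integrable_oneDsqrV : mu.-integrable setT (fun t => ((oneDsqr t)^-1)%:E).
Proof.
apply/integrableP; split.
  apply/measurable_EFinP; apply: continuous_measurable_fun.
  exact: continuous_oneDsqrV.
under eq_integral do rewrite abse_EFin ger0_norm ?invr_ge0//.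
rewrite ge0_symfun_integralT//.
- rewrite -set_itvcy integral0y_oneDsqr -EFinM ltry//.
- exact: continuous_oneDsqrV.
- by move=> t /=; rewrite /oneDsqr sqrrN.
Qed.

(** The fundamental theorem of calculus on growing symmetric intervals, then dominated
    convergence. *)
Lemma integral_derive_eq0 (h g : R -> R) (C : R) :
    (forall t : R, is_derive t 1 h (g t)) -> continuous g ->
    (forall t, `|g t| <= C / (1 + t ^+ 2)) ->
    h n%:R @[n --> \oo] --> (0 : R) -> h (- n%:R) @[n --> \oo] --> (0 : R) ->
  (\int[mu]_(t in setT) (g t)%:E = 0)%E.
Proof.
move=> dh cg gC hy hNy.
pose I n : set R := `[- n.+1%:R, n.+1%:R]%classic.
pose g_ n := (EFin \o g) \_ (I n).
have mI n : measurable (I n) by exact: measurable_itv.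
have mg : measurable_fun setT (EFin \o g).
  by apply/measurable_EFinP; exact: continuous_measurable_fun.
have mg_ n : measurable_fun setT (g_ n).
  by apply/(measurable_restrictT _ _).1 => //; exact: measurable_funTS.
have ig : mu.-integrable setT (fun t => (C%:E * ((oneDsqr t)^-1)%:E)%E).
  by apply: integrableZl => //; exact: integrable_oneDsqrV.
have g_cvg t : g_ ^~ t @ \oo --> (g t)%:E.
  apply: cvg_near_cst.
  near=> n; rewrite /g_ patchE ifT//= inE /I/= in_itv/= -ler_norml.
  near: n; exists (Num.trunc `|t|) => // n /= tn.
  by rewrite (le_trans (ltW (truncnS_gt _)))// ler_nat ltnS.
have g_le t n : (`|g_ n t| <= C%:E * ((oneDsqr t)^-1)%:E)%E.
  rewrite /g_ patchE; case: ifPn => _; first by rewrite lee_fin gC.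
  by rewrite abse0 -EFinM lee_fin (le_trans _ (gC t)).
have ae_cvg : {ae mu, forall t, setT t -> g_ ^~ t @ \oo --> (EFin \o g) t}.
  by apply: aeW => t _; exact: g_cvg.
have ae_le : {ae mu, forall t n, setT t -> (`|g_ n t| <= C%:E * ((oneDsqr t)^-1)%:E)%E}.
  by apply: aeW => t n _; exact: g_le.
have [_ _] := @dominated_convergence _ (measurableTypeR R) R mu setT measurableT g_ (EFin \o g) _ mg_ mg
  ae_cvg ig ae_le.
have -> : [sequence (\int[mu]_(x in setT) g_ n x)%E]_n = (fun n => (h n.+1%:R - h (- n.+1%:R))%:E).
  apply/funext => n /=; rewrite /g_ -integral_mkcond.
  have dc t : {for t, continuous h}.
    by have [/derivable1_diffP/differentiable_continuous + _] := dh t.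
  rewrite (@continuous_FTC2 _ g h)//.
  - by rewrite (lt_trans (y := 0)) ?oppr_lt0 ?ltr0Sn.
  - exact: continuous_subspaceT.
  - split; first by move=> t _; have [] := dh t.
    + by apply: cvg_at_right_filter; exact: dc.
    + by apply: cvg_at_left_filter; exact: dc.
  - by move=> t _; rewrite derive1E; have [] := dh t.
have h0 : (fun n => (h n.+1%:R - h (- n.+1%:R))%:E) @ \oo --> (0 - 0 : R)%:E.
  apply: cvg_EFin; first exact: nearW.
  apply: cvgB; first by rewrite (cvg_shiftS (fun n : nat => h n%:R)).
  by rewrite (cvg_shiftS (fun n : nat => h (- n%:R))).
rewrite subr0 in h0 => /cvg_unique; apply => //.
Unshelve. all: by end_near. Qed.

End line_integrals.

(** * Non-vanishing arbitrarily far along every ray *)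

Section nonvanishing.
Context {R : realType}.
Implicit Types (w v : R * R) (a t : R).

Lemma cos_natmul2pi k : cos (k%:R * (pi *+ 2)) = 1 :> R.
Proof.
elim: k => [|k ih]; first by rewrite mul0r cos0.
by rewrite -natr1 mulrDl mul1r cosD2pi.
Qed.

Lemma cos_mul_sinB_eq1 (x B : R) : `|x| < pi ->
  exists2 r : R, B < r & cos (r * sin x - x) = 1.
Proof.
wlog x0 : x / 0 <= x.
  move=> wl xpi; have [x0|x0] := leP 0 x; first exact: wl.
  have [||r Br r1] := wl (- x); rewrite ?normrN ?oppr_ge0 ?ltW//.
  by exists r => //; rewrite -r1 sinN -[in LHS]cosN; congr cos; ring.
rewrite ger0_norm// => xpi; move: x0; rewrite le_eqVlt => /predU1P[<-|x0].
  by exists (B + 1); rewrite ?ltrDl// sin0 mulr0 subr0 cos0.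
have s0 : 0 < sin x by rewrite sin_gt0_pi// x0.
pose k := (Num.trunc B).+1.
have kB : B < k%:R by exact: truncnS_gt.
(* The solution r of r sin x - x = 2 pi k; it exceeds B because k > B and 0 < sin x <= 1. *)
exists ((x + k%:R * (pi *+ 2)) / sin x); last first.
  by rewrite divfK ?gt_eqF// addrC addKr cos_natmul2pi.
have k0 : 0 <= k%:R :> R by [].
have p2 := @pi_ge2 R; have s1 := sin_le1 x.
rewrite ltr_pdivlMr// mulr2n; move: (k%:R) (pi) (sin x) kB k0 p2 s0 s1 => K p S kB k0 p2 s0 s1.
apply: (@le_lt_trans _ _ K); last first.
  by have : 0 <= K * (p - 2) by [rewrite mulr_ge0// subr_ge0]; lra.
have [B0|/ltW B0] := leP 0 B; first by rewrite (le_trans _ (ltW kB))// ler_piMr.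
by rewrite (le_trans _ k0)// mulr_le0_ge0// ltW.
Qed.

Lemma argZ (s : R) w : 0 < s -> arg (s *: w) = arg w.
Proof.
move=> s0; rewrite /arg enormZ ?ltW//= /GRing.scale/= -mulrDr.
by rewrite -mulf_div divff ?gt_eqF// mul1r.
Qed.

(** With r = s^a and phi = a arg n, the bracket in [Fre] is cos(r sin phi) - a r cos(r sin phi -
    phi). Where the last cosine is 1 and a r > 1, it is negative. *)
Lemma Fre_ray_neq0 a (n : R * R) (M : R) : 0 < a -> a < 2^-1 -> enorm n = 1 ->
  exists2 s : R, M < s & Fre a (s *: n) <> 0.
Proof.
move=> a0 a2 n1.
have api : `|a * arg n| < pi.
  have p0 := @pi_gt0 R; rewrite normrM gtr0_norm//.
  by rewrite (@le_lt_trans _ _ (a * pi)) ?ler_pM2l ?normr_arg//; nra.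
(* Exceeding |M|^a gives s > M, and exceeding 1 / a gives a r > 1. *)
have [r rB r1] := cos_mul_sinB_eq1 (Num.max (`|M| `^ a) a^-1) api.
move: rB; rewrite gt_max => /andP[rM ra].
have r0 : 0 < r by rewrite (le_lt_trans _ ra)// invr_ge0 ltW.
exists (r `^ a^-1).
  rewrite (le_lt_trans (ler_norm _))// ltNge; apply/negP => rs.
  have := ge0_ler_powR (ltW a0) (powR_ge0 _ _) (normr_ge0 _) rs.
  by rewrite -powRrM mulVf ?gt_eqF// powRr1 ?(ltW r0)// leNgt rM.
have s0 : 0 < r `^ a^-1 by rewrite powR_gt0.
rewrite /Fre /repow /impow argZ// enormZ ?ltW// n1 mulr1.
rewrite -powRrM mulVf ?gt_eqF// powRr1 ?(ltW r0)//.
have -> : (1 - a * (r * cos (a * arg n))) * cos (r * sin (a * arg n))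
  - a * (r * sin (a * arg n)) * sin (r * sin (a * arg n)) =
  cos (r * sin (a * arg n)) - a * r * cos (r * sin (a * arg n) - a * arg n).
  by rewrite cosB; ring.
rewrite r1 mulr1; apply/eqP; rewrite mulf_eq0 negb_or gt_eqF ?expR_gt0//=.
rewrite lt_eqF// subr_lt0 (le_lt_trans (cos_le1 _))//.
by rewrite mulrC -ltr_pdivrMr// mul1r.
Qed.

End nonvanishing.

(** * Half-lines in unbounded closed convex sets *)

Section recession.
Context {R : realType}.
Implicit Types (K : set (R * R)) (x y p v w : R * R).

Lemma convex_set_segment K x y s : convex_set K -> K x -> K y -> 0 <= s -> s <= 1 ->
  K (y + s *: (x - y)).
Proof.
move=> cK Kx Ky s0 s1; have := cK x y (Itv01 s0 s1) (mem_set Kx) (mem_set Ky).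
suff -> : y + s *: (x - y) = s *: x + (1 - s) *: y by rewrite inE.
by rewrite scalerBl scalerBr scale1r addrCA.
Qed.

Lemma unbounded_set_norm K (M : R) : ~ bounded_set K -> exists2 x, K x & M < `|x|.
Proof.
move=> ubK; apply: contrapT => noK; apply: ubK; exists M; split; first exact: num_real.
move=> N MN x Kx /=; rewrite leNgt; apply/negP => Nx.
by apply: noK; exists x => //; exact: lt_trans Nx.
Qed.

Lemma nbhs_ray p w t (B : set (R * R)) : nbhs (p + t *: w) B ->
  nbhs w [set v | B (p + t *: v)].
Proof.
apply: (_ : {for w, continuous (fun v => p + t *: v)}).
by apply: cvgD; [exact: cvg_cst|apply: cvgZl_tmp; exact: cvg_id].
Qed.

(** Passes from any nonzero direction to a Euclidean unit one; the compactness argument below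
    normalizes in the max norm. *)
Lemma half_line_scale K p w : w <> 0 -> (forall t, 0 <= t -> K (p + t *: w)) ->
  contains_half_line K.
Proof.
move=> w0 Kw; have ew : 0 < enorm w.
  by rewrite lt_neqAle enorm_ge0 andbT eq_sym; apply/eqP => /enorm_eq0.
exists p, ((enorm w)^-1 *: w); split.
  by rewrite enormZ ?invr_ge0 ?enorm_ge0// mulVf ?gt_eqF.
move=> _ [t /= t0 <-]; rewrite scalerA; apply: Kw.
by rewrite mulr_ge0// invr_ge0 enorm_ge0.
Qed.

(* The direction is a cluster point of the directions from a base point p to
   points of K at distance at least n. *)
Lemma closed_convex_unbounded_half_line K :
  closed K -> convex_set K -> ~ bounded_set K -> contains_half_line K.
Proof.
move=> clK cK ubK.
have [p Kp _] := unbounded_set_norm 0 ubK.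
have exv (n : nat) : exists v : R * R, `|v| = 1 /\ K (p + n%:R *: v).
  have [x Kx nx] := unbounded_set_norm (n%:R + `|p|) ubK.
  have d1 : n%:R < `|x - p| by rewrite -(ltrD2r `|p|) (lt_le_trans nx)// -{1}(subrK p x) ler_normD.
  have d0 : 0 < `|x - p| by rewrite (le_lt_trans _ d1).
  exists (`|x - p|^-1 *: (x - p)); split.
    by rewrite normrZ gtr0_norm ?invr_gt0// mulVf ?gt_eqF.
  rewrite scalerA; apply: convex_set_segment => //.
  by rewrite ler_pdivrMr// mul1r ltW.
have [v_ v_P] := choice exv.
(* The point lies on the segment from [p] to [p + n%:R *: v_ n]. *)
have Kle (m n : nat) : (m <= n)%N -> K (p + m%:R *: v_ n).
  case: n => [|n] mn; first by move: mn; rewrite leqn0 => /eqP ->; rewrite scale0r addr0.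
  have := convex_set_segment (s := m%:R / n.+1%:R) cK (v_P n.+1).2 Kp.
  rewrite addrAC subrr add0r scalerA divfK ?pnatr_eq0//; apply.
    by rewrite divr_ge0.
  by rewrite ler_pdivrMr ?ltr0Sn// mul1r ler_nat.
have cS : compact (`[(-1 : R), 1] `*` `[(-1 : R), 1]).
  by apply: compact_setX; exact: segment_compact.
have [|w [_ clw]] := cS (v_ @ \oo) _.
  exists 0%N => // n _; have [+ _] := v_P n.
  rewrite prod_normE => /eqP; rewrite eq_le ge_max => /andP[/andP[n1 n2] _].
  by split; rewrite /= in_itv/= -ler_norml.
(* For fixed m, all v_n with n >= m give points of K; closedness carries this to the cluster
   point. *)
have Kw (m : nat) : K (p + m%:R *: w).
  apply: clK => B /nbhs_ray nB.
  have [|v [Kv Bv]] := clw [set v | K (p + m%:R *: v)] _ _ nB.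
    by exists m => // n /= mn; exact: Kle.
  by exists (p + m%:R *: v).
apply: (@half_line_scale _ p w).
  (* The open unit ball about 0 contains no vector of norm 1, so 0 is not a cluster point. *)
  move=> w0; have [|v [v1 vw]] := clw [set v | `|v| = 1] _ _ (nbhsx_ballx w 1 ltr01).
    by exists 0%N => // n _; exact: (v_P n).1.
  by move: vw; rewrite -ball_normE/= w0 sub0r normrN v1 ltxx.
move=> t t0; pose m := (Num.trunc t).+1.
have tm : t < m%:R by exact: truncnS_gt.
have := convex_set_segment (s := t / m%:R) cK (Kw m) Kp.
rewrite addrAC subrr add0r scalerA divfK ?pnatr_eq0//; apply.
  by rewrite divr_ge0.
by rewrite ler_pdivrMr ?ltr0Sn// mul1r ltW.
Qed.

End recession.

(** * The complement of a half-line *)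

Section half_line_complement.
Context {R : realType}.
Implicit Types (c n p u v w x y : R * R) (a t : R).

(** Multiplication by the complex number c, a rotation when |c| = 1. *)
Definition rot c x : R * R := (c.1 * x.1 - c.2 * x.2, c.1 * x.2 + c.2 * x.1).

Lemma enorm_rot c x : enorm c = 1 -> enorm (rot c x) = enorm x.
Proof.
move=> /enorm1_dotp c1; apply/eqP; rewrite -(@eqrXn2 _ 2) ?enorm_ge0//.
rewrite !sqr_enorm /= -[X in _ == X]mul1r -c1; apply/eqP; ring.
Qed.

Lemma rotD c x y : rot c (x + y) = rot c x + rot c y.
Proof. by rewrite /rot; congr pair; rewrite /=; ring. Qed.

Lemma rotZ c (s : R) x : rot c (s *: x) = s *: rot c x.
Proof. by rewrite /rot; congr pair; rewrite /= /GRing.scale/=; ring. Qed.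

(* With points read as complex numbers this is x |-> - conj(u) (x - p), which
   maps the half-line onto the nonpositive real axis. *)
Definition frame p u x := rot (- u.1, u.2) (x - p).

Lemma enorm_conj u : enorm (- u.1, u.2) = enorm u.
Proof. by rewrite /enorm /dotp /= mulrNN. Qed.

Lemma enorm_frame p u x : enorm u = 1 -> enorm (frame p u x) = enorm (x - p).
Proof. by move=> u1; rewrite enorm_rot// enorm_conj. Qed.

Lemma frame_line p u x y (s : R) :
  frame p u (x + s *: y) = frame p u x + s *: rot (- u.1, u.2) y.
Proof. by rewrite /frame [x + _ - p]addrAC (rotD _ (x - p)) rotZ. Qed.

Lemma slit_frame p u x : enorm u = 1 -> ~ half_line p u x -> slit (frame p u x).
Proof.
move=> /enorm1_dotp u1 xL; rewrite /slit /= ltNge; apply/negP => r0; apply: xL.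
have := enorm_ge0 (frame p u x); have := sqr_enorm (frame p u x).
move: r0; rewrite /frame/=; move: (enorm _) => r r0 r2 rge0.
(* From r + X <= 0 and r^2 = X^2 + Y^2 follow Y = 0 and X <= 0; the parameter on the half-line is
   then -X. *)
have y0 : - u.1 * (x - p).2 + u.2 * (x - p).1 = 0.
  by apply/eqP; rewrite -sqrf_eq0 eq_le sqr_ge0 andbT; nra.
exists (u.1 * (x - p).1 + u.2 * (x - p).2); first by rewrite /= in r0 *; lra.
have -> : x = p + (x - p) by rewrite addrCA subrr addr0.
congr (p + _); rewrite addrCA subrr addr0; case: (x - p) y0 => d1 d2 /= y0.
congr pair; rewrite /= /GRing.scale/=.
  transitivity (d1 * (u.1 ^+ 2 + u.2 ^+ 2) - u.2 * (- u.1 * d2 + u.2 * d1)); first by ring.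
  by rewrite y0 u1; ring.
transitivity (d2 * (u.1 ^+ 2 + u.2 ^+ 2) + u.1 * (- u.1 * d2 + u.2 * d1)); first by ring.
by rewrite y0 u1; ring.
Qed.

Lemma continuous_line p v : continuous (fun t : R => p + t *: v).
Proof. by move=> t; apply: cvgD; [exact: cvg_cst|apply: cvgZr_tmp; exact: cvg_id]. Qed.

Lemma continuous_frame p u : continuous (frame p u).
Proof.
move=> x.
have c1 : (fun y : R * R => (y - p).1) @ x --> (x - p).1.
  by apply: cvgB; [exact: cvg_fst|exact: cvg_cst].
have c2 : (fun y : R * R => (y - p).2) @ x --> (x - p).2.
  by apply: cvgB; [exact: cvg_snd|exact: cvg_cst].
have h1 : (fun y : R * R => - u.1 * (y - p).1 - u.2 * (y - p).2) @ x -->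
    - u.1 * (x - p).1 - u.2 * (x - p).2.
  by apply: cvgB; apply: cvgM => //; exact: cvg_cst.
have h2 : (fun y : R * R => - u.1 * (y - p).2 + u.2 * (y - p).1) @ x -->
    - u.1 * (x - p).2 + u.2 * (x - p).1.
  by apply: cvgD; apply: cvgM => //; exact: cvg_cst.
exact: (cvg_pair h1 h2).
Qed.

Lemma cvg0_le_harmonic (D : R) (h : nat -> R) :
  (forall n : nat, `|h n| <= D * (1 + n%:R)^-1) -> h @ \oo --> (0 : R).
Proof.
move=> hD; have D0 : D * harmonic k @[k --> \oo] --> (0 : R).
  by rewrite -(mulr0 D); apply: cvgM; [exact: cvg_cst|exact: cvg_harmonic].
apply: (@squeeze_cvgr _ _ _ _ (fun k => - (D * harmonic k)) (fun k => D * harmonic k)).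
- by apply: nearW => k; rewrite -ler_norml /harmonic /= -natr1 addrC.
- by rewrite -oppr0; exact: cvgN.
- exact: D0.
Qed.

Lemma line_integral_Fre_eq0 a p v : 0 < a -> a < 2^-1 -> enorm v = 1 ->
  line p v `<=` slit -> line_integral (Fre a) p v = 0%E.
Proof.
move=> a0 a2 v1 pv; pose z t := p + t *: v.
have sz t : slit (z t) by apply: pv; exists t.
have tz t : `|t| <= enorm (z t) + enorm p.
  have -> : `|t| = enorm (z t - p).
    rewrite /z addrAC subrr add0r; apply/eqP; rewrite -(@eqrXn2 _ 2) ?enorm_ge0//.
    by rewrite real_normK ?num_real// sqr_enorm /= !exprMn -mulrDr enorm1_dotp ?mulr1.
  by rewrite -(enormN p) enormD.
have k0 : 0 < cos (a * pi) := cos_api_gt0 a0 a2.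
have a1 : a <= 1 by lra.
have [C C0 decay] := stretched_exp_decay k0 a0 a1.
have m0 := enorm_ge0 p; set m := enorm p in tz m0.
(* Uses r (1 + |t|) <= r (1 + r + m) <= 2 (1 + r^2)(1 + m), where r = |z(t)|. *)
have hD t : `|Phire a v (z t)| <= 2 * C * (1 + m) * (1 + `|t|)^-1.
  apply: le_trans (normr_Phire _ a0 a2 v1) _.
  have := decay _ (enorm_ge0 (z t)); have := tz t; have := enorm_ge0 (z t).
  have := powR_ge0 (enorm (z t)) a; have := expR_ge0 (- (cos (a * pi) * enorm (z t) `^ a)).
  have := normr_ge0 t.
  move: `|t| (enorm (z t)) (_ `^ a) (expR _) => T r q E T0 E0 q0 r0 Trm.
  rewrite !ler_pdivlMr ?ltr_pwDl ?sqr_ge0// => EC.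
  have Er : E * (1 + r ^+ 2) <= C.
    by apply: le_trans EC; rewrite ler_wpM2r ?addr_ge0 ?sqr_ge0// ler_peMr// lerDl.
  apply: (@le_trans _ _ (E * (2 * (1 + r ^+ 2)) * (1 + m))).
    rewrite -!mulrA ler_wpM2l//; have := mulr_ge0 m0 (sqr_ge0 r).
    by have := mulr_ge0 r0 m0; have := sqr_ge0 (r - 1); nra.
  by rewrite ler_wpM2r ?addr_ge0// mulrCA ler_pM2l.
(* The constant comes from t^2 <= (r + m)^2 <= 2 r^2 + 2 m^2, so 1 + t^2 <= (2 + 2 m^2)(1 + r^2). *)
apply: (@integral_derive_eq0 _ (fun t => Phire a v (z t)) _ (C * (2 + 2 * m ^+ 2))).
- move=> t; apply: is_derive_Phire => //.
    by rewrite /z /=; apply: is_derive_eq; rewrite /GRing.scale/=; ring.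
  by rewrite /z /=; apply: is_derive_eq; rewrite /GRing.scale/=; ring.
- move=> t; apply: (@continuous_comp _ _ _ z (Fre a)); first exact: continuous_line.
  exact: continuous_Fre.
- move=> t; apply: le_trans (normr_Fre _ a0 a2) _.
  apply: le_trans (decay _ (enorm_ge0 _)) _.
  have r0 := enorm_ge0 (z t).
  rewrite ler_pdivrMr ?ltr_pwDl ?sqr_ge0// mulrAC ler_pdivlMr ?ltr_pwDl ?sqr_ge0//.
  rewrite -mulrA ler_pM2l//.
  have : t ^+ 2 <= (enorm (z t) + m) ^+ 2.
    by rewrite -[t ^+ 2]real_normK ?num_real// ler_sqr ?nnegrE ?addr_ge0.
  have := sqr_ge0 (enorm (z t) - m); have := sqr_ge0 (enorm (z t) * m).
  move: (enorm _) => r; nra.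
- apply: (@cvg0_le_harmonic (2 * C * (1 + m))) => n.
  by apply: le_trans (hD _) _; rewrite normr_nat.
- apply: (@cvg0_le_harmonic (2 * C * (1 + m))) => n.
  by apply: le_trans (hD _) _; rewrite normrN normr_nat.
Qed.

(** The half-plane [b < dotp n x] stands for the side of the angle's boundary that K cannot
    reach. *)
Lemma half_line_complement_null_function a p u n (b : R) :
  0 < a -> a < 2^-1 -> enorm u = 1 -> enorm n = 1 ->
  let f x := Fre a (frame p u x) in
  [/\ forall x, ~ half_line p u x -> {for x, continuous f},
      exists2 x : R * R, b < dotp n x & f x <> 0,
      exists theta C : R, [/\ 0 < theta, 0 < C &
        forall x, `|f x| <= C * expR (- theta * enorm x `^ a)]
    & forall q v, enorm v = 1 -> line q v `<=` ~` half_line p u ->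
        line_integral f q v = 0%E].
Proof.
move=> a0 a2 u1 n1 f; have c1 : enorm (- u.1, u.2) = 1 by rewrite enorm_conj.
split.
- move=> x xL; apply: (@continuous_comp _ _ _ (frame p u) (Fre a)).
    exact: continuous_frame.
  by apply: continuous_Fre; exact: slit_frame.
- have [|s sM fs] := @Fre_ray_neq0 _ a (rot (- u.1, u.2) n) (b - dotp n p) a0 a2.
    by rewrite enorm_rot.
  exists (p + s *: n).
    have -> : dotp n (p + s *: n) = dotp n p + s * (n.1 ^+ 2 + n.2 ^+ 2).
      by rewrite /dotp /= /GRing.scale/=; ring.
    by rewrite enorm1_dotp// mulr1 -ltrBlDl.
  rewrite /f frame_line; have -> : frame p u p = 0.
    by rewrite /frame subrr /rot; congr pair; rewrite /= ?mulr0 ?subr0 ?addr0.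
  by rewrite add0r.
- have k0 := cos_api_gt0 a0 a2; have a1 : a <= 1 by lra.
  set k := cos (a * pi) in k0.
  (* The last factor pays for recentring from p to 0, through |x|^a <= |x - p|^a + |p|^a. *)
  exists (k / 2), ((1 + 2 / k) * expR (k / 2 * enorm p `^ a)); split.
  + by rewrite divr_gt0.
  + by rewrite mulr_gt0 ?expR_gt0// addr_gt0// divr_gt0.
  move=> x; apply: le_trans (normr_Fre _ a0 a2) _.
  apply: le_trans (stretched_exp_absorb k0 (powR_ge0 _ _)) _.
  rewrite -[leRHS]mulrA ler_pM2l ?addr_gt0 ?divr_gt0// -expRD ler_expR enorm_frame//.
  have : enorm x `^ a <= enorm (x - p) `^ a + enorm p `^ a.
    apply: le_trans (powR_subadditive (enorm_ge0 _) (enorm_ge0 _) a0 a1).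
    by rewrite ge0_ler_powR ?nnegrE ?addr_ge0 ?enorm_ge0 ?(ltW a0)// -{1}(subrK p x) enormD.
  by move=> xr; rewrite mulNr lerNl opprD opprK addrC -mulrBr ler_pM2l ?divr_gt0// lerBlDr.
- move=> q v v1 qv.
  have zq t : f (q + t *: v) = Fre a (frame p u q + t *: rot (- u.1, u.2) v).
    by rewrite /f frame_line.
  rewrite /line_integral; under eq_integral do rewrite zq.
  apply: line_integral_Fre_eq0 => //; first by rewrite enorm_rot.
  move=> _ [t _ <-]; rewrite -frame_line; apply: slit_frame => //.
  by apply: qv; exists t.
Qed.

End half_line_complement.

Unset Implicit Arguments.

Theorem mainTheorem4 (R : realType) (K : set (R * R))
    (hK : [/\ closed K, convex_set K, contained_in_angle K
            & contains_half_line K]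
          \/ parabolic_domain K)
    (eps : R) (eps_gt0 : 0 < eps) (eps_lt : eps < 2^-1) :
  exists (theta C : R) (f : R * R -> R),
    [/\ 0 < theta /\ 0 < C,
        {within ~` K, continuous f},
        exists2 x : R * R, (~` K) x & f x <> 0,
        forall x : R * R, (~` K) x ->
          `|f x| <= C * expR (- theta * enorm x `^ (2^-1 - eps))
      & forall p v : R * R, enorm v = 1 -> line p v `<=` ~` K ->
          line_integral f p v = 0%E].
Proof.
have [[A [n [m [b [d [n1 _ _ AE]]]]] KA] [p [u [u1 pK]]]] :
    contained_in_angle K /\ contains_half_line K.
  case: hK => [[]//|[clK cK ubK angK _]]; split => //.
  exact: closed_convex_unbounded_half_line.
have a0 : 0 < 2^-1 - eps by rewrite subr_gt0.
have a2 : 2^-1 - eps < 2^-1 by rewrite ltrBlDr ltrDl.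
have [cf [x bx fx] [theta [C [theta0 C0 fC]]] fl] :=
  half_line_complement_null_function p b a0 a2 u1 n1.
exists theta, C, (fun x => Fre (2^-1 - eps) (frame p u x)); split => //.
- apply: continuous_in_subspaceT => y; rewrite inE => Ky.
  by apply: cf => py; apply: Ky; exact: pK.
(* The point x violates the first half-plane of the angle, so it is outside K. *)
- exists x => // /KA; rewrite AE => -[/= xb _].
  by move: bx; rewrite ltNge; apply/negP/negPn.
- move=> q v v1 qv; apply: fl => // y lqy py; apply: (qv y lqy); exact: pK.
Qed.
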